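(* Let $n\ge3$ and $b\ge2$, and let $P=P_b$ be the transition matrix of the base-$b$ carries chain for adding $n$ numbers, with stationary distribution $\pi(j)=A(n,j)/n!$. Then for every starting state $i\in\{0,\dots,n-1\}$ and every $r\ge0$, $$\|P^r(i,\cdot)-\pi\|_{TV}\le\Big(\frac{n-1}{2}+i\Big)\Big/b^r.$$ Conversely, for every $0<\epsilon<1$, if $r$ is an integer with $1\le r\le\log_b\!\Big[\frac{\epsilon\,|i-\frac{n-1}{2}|}{\sqrt n}\Big]$, then $\|P^r(i,\cdot)-\pi\|_{TV}\ge1-\epsilon$.
   Context: $A(n,j)$ is the number of permutations in $S_n$ with exactly $j$ descents. The base-$b$ carries chain for adding $n$ numbers is the Markov chain on $\{0,\dots,n-1\}$ given by $\kappa_{t+1}=\lfloor(\kappa_t+X_{t+1,1}+\dots+X_{t+1,n})/b\rfloor$ with $X_{t,k}$ i.i.d. uniform on $\{0,\dots,b-1\}$; its transition matrix is $P_b(i,j)=b^{-n}\sum_{l=0}^{j-\lfloor i/b\rfloor}(-1)^l\binom{n+1}{l}\binom{n-1-i+(j+1-l)b}{n}$ (with $\binom{m}{n}=0$ for $m<n$). $\|P-Q\|_{TV}=\frac12\sum_x|P(x)-Q(x)|$. *)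

(* Defs.v *)
From Stdlib Require Import Reals.
From mathcomp Require Import all_boot all_fingroup.
Set Implicit Arguments. Unset Strict Implicit. Unset Printing Implicit Defensive.

Definition descents (n : nat) (s : 'S_n) : nat :=
  #|[set k : 'I_n | [exists k' : 'I_n,
      (nat_of_ord k' == k.+1) && (nat_of_ord (s k') < nat_of_ord (s k))]]|.

Definition eulerian (n j : nat) : nat := #|[set s : 'S_n | descents s == j]|.

Open Scope R_scope.

Fixpoint rsum (m : nat) (f : nat -> R) : R :=
  match m with O => 0 | S k => rsum k f + f k end.

(* transition matrix of the base-b carries chain for adding n numbers,
   P_b(i,j) = b^{-n} sum_{l=0}^{j - floor(i/b)} (-1)^l C(n+1,l) C(n-1-i+(j+1-l)b, n)
   (empty sum when j < floor(i/b)); states are 0..n-1. *)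
Definition carriesP (b n i j : nat) : R :=
  / (INR b ^ n) *
  (if (i %/ b <= j)%N then
     rsum (j - i %/ b).+1 (fun l =>
       (-1) ^ l * INR 'C(n.+1, l) * INR 'C((n - 1 - i) + (j + 1 - l) * b, n))
   else 0).

Fixpoint carriesPpow (b n r i j : nat) : R :=
  match r with
  | O => if Nat.eqb i j then 1 else 0
  | S r' => rsum n (fun k => carriesPpow b n r' i k * carriesP b n k j)
  end.

Definition carriesPi (n j : nat) : R := INR (eulerian n j) / INR (n `!).

Definition tv (n : nat) (mu nu : nat -> R) : R :=
  / 2 * rsum n (fun x => Rabs (mu x - nu x)).

Definition logb (b x : R) : R := ln x / ln b.

(* Main.v *)
(* The transition operator P f (i) = E f(floor((i + X_1 + ... + X_n) / b)) makes
   sense on all of the naturals.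

   Upper bound: moving i to i + 1 changes the next carry with probability 1/b,
   and then by one, so P divides Lipschitz constants by b. If pi is stationary,
   testing against the sign of P^r(i,.) - pi bounds the distance by
   sum_k pi(k) |i - k| / b^r, and pi has mean (n-1)/2.

   Lower bound: P multiplies k - (n-1)/2 by 1/b, and the variances of
   P^r(i,.) and of pi are at most (n+3)/12; the means are then too far apart for
   the two distributions to overlap much.

   Stationarity: by Worpitzky's identity, sum_i A(n,i) P_b(i,j) does not depend
   on b, and P_1 is the identity. *)

Require Import Defs.
From Stdlib Require Import Reals Lra.
From mathcomp Require Import all_boot all_fingroup zify.
Open Scope R_scope.

(** * Finite real sums *)

Lemma rsum_ext n f g :
  (forall k, (k < n)%N -> f k = g k) -> rsum n f = rsum n g.
Proof.
elim: n => //= n IHn fg; rewrite IHn ?fg // => k kn.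
by apply: fg; apply: ltnW.
Qed.

Lemma rsum_le n f g :
  (forall k, (k < n)%N -> f k <= g k) -> rsum n f <= rsum n g.
Proof.
elim: n => [|n IHn] fg /=; first lra.
apply: Rplus_le_compat; last exact: fg.
by apply: IHn => k kn; apply: fg; apply: ltnW.
Qed.

Lemma rsumD n f g : rsum n (fun k => f k + g k) = rsum n f + rsum n g.
Proof. by elim: n => /= [|n ->]; lra. Qed.

Lemma rsumZ n c f : rsum n (fun k => c * f k) = c * rsum n f.
Proof. by elim: n => /= [|n ->]; lra. Qed.

Lemma rsum_const n c : rsum n (fun=> c) = INR n * c.
Proof. by elim: n => [|n IHn]; [simpl; lra | rewrite S_INR /= IHn; lra]. Qed.

Lemma rsum_exchange n m (f : nat -> nat -> R) :
  rsum n (fun i => rsum m (f i)) = rsum m (fun j => rsum n (f ^~ j)).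
Proof.
elim: n => /= [|n ->]; first by rewrite rsum_const; lra.
by rewrite -rsumD.
Qed.

Lemma rsum_split m p f :
  rsum (m + p) f = rsum m f + rsum p (fun k => f (m + k)%N).
Proof. by elim: p => /= [|p IHp]; rewrite ?addn0 ?addnS /= ?IHp; lra. Qed.

Lemma rsum_trunc m p f : (m <= p)%N ->
  (forall k, (m <= k < p)%N -> f k = 0) -> rsum p f = rsum m f.
Proof.
move=> mp f0; rewrite -(subnKC mp) rsum_split.
rewrite (@rsum_ext (p - m) _ (fun=> 0)) ?rsum_const; first lra.
by move=> k kp; apply: f0; lia.
Qed.

Lemma rsum_recl n f : rsum n.+1 f = f 0%N + rsum n (fun k => f k.+1).
Proof. by rewrite -addn1 addnC rsum_split [rsum 1 f]/=; have -> : (fun k => f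
  (1 + k)%N) = (fun k => f k.+1) by []; lra. Qed.

Lemma rsum_delta n j f : (j < n)%N ->
  rsum n (fun k => (if k == j then 1 else 0) * f k) = f j.
Proof.
move=> jn; rewrite (@rsum_trunc j.+1) //=; last first.
  by move=> k kj; case: eqP => [?|_]; [lia | lra].
rewrite eqxx (@rsum_ext j _ (fun=> 0)) ?rsum_const; first lra.
by move=> k kj; case: eqP => [?|_]; [lia | lra].
Qed.

(** Squared distance to the midpoint plus the variance $(n^2-1)/12$ of a uniform variable on [n]
    consecutive integers. *)
Lemma rsum_sqr_shift n x :
  rsum n (fun t => (x + INR t) ^ 2) =
  INR n * ((x + (INR n - 1) / 2) ^ 2 + (INR n ^ 2 - 1) / 12).
Proof. by elim: n => [|n IHn]; [simpl; lra | rewrite S_INR /= IHn; field]. Qed.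

Lemma rsum_shift n x :
  rsum n (fun t => x + INR t) = INR n * (x + (INR n - 1) / 2).
Proof. by elim: n => [|n IHn]; [simpl; lra | rewrite S_INR /= IHn; field]. Qed.

(** * The digit average and the one-step operator *)

(* [avg b g s] is the mean of [g (s + X)] for [X] uniform on {0, ..., b-1}, so
   [carry b n] is the one-step operator of the carries chain, extended to all
   states in [nat]. *)
Definition avg (b : nat) (g : nat -> R) (s : nat) : R :=
  / INR b * rsum b (fun t => g (s + t)%N).

Definition carry (b n : nat) (f : nat -> R) : nat -> R :=
  iter n (avg b) (fun s => f (s %/ b)%N).

Section Carry.

Variable b : nat.
Hypothesis b_gt0 : (0 < b)%N.

Lemma INRb_gt0 : 0 < INR b.
Proof. by apply: lt_0_INR; apply/ltP. Qed.

(** Each digit adds at most [b - 1]; this locality later confines the chain to its [n] states. *)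
Lemma iter_avg_local n g h i :
  (forall s, (s <= i + n * (b - 1))%N -> g s = h s) ->
  iter n (avg b) g i = iter n (avg b) h i.
Proof.
elim: n i => [|n IHn] i gh /=; first by apply: gh; lia.
rewrite /avg; congr (_ * _); apply: rsum_ext => t tb.
by apply: IHn => s ?; apply: gh; nia.
Qed.

Lemma iter_avg_ext n g h i :
  g =1 h -> iter n (avg b) g i = iter n (avg b) h i.
Proof. by move=> gh; apply: iter_avg_local => s _. Qed.

Lemma iter_avg_le n g h i :
  (forall s, g s <= h s) -> iter n (avg b) g i <= iter n (avg b) h i.
Proof.
move=> gh; elim: n i => [|n IHn] i //=; rewrite /avg.
apply: Rmult_le_compat_l; first by have := Rinv_0_lt_compat _ INRb_gt0; lra.
by apply: rsum_le => t _.
Qed.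

Lemma iter_avgD n g h i :
  iter n (avg b) (fun s => g s + h s) i =
  iter n (avg b) g i + iter n (avg b) h i.
Proof.
elim: n i => [|n IHn] i //=.
by rewrite /avg -Rmult_plus_distr_l -rsumD; congr (_ * _); apply: rsum_ext.
Qed.

Lemma iter_avgZ n c g i :
  iter n (avg b) (fun s => c * g s) i = c * iter n (avg b) g i.
Proof.
elim: n i => [|n IHn] i //=.
transitivity (avg b (fun s => c * iter n (avg b) g s) i).
  by rewrite /avg; congr (_ * _); apply: rsum_ext.
by rewrite {1}/avg rsumZ /avg; lra.
Qed.

Lemma iter_avg_const n c i : iter n (avg b) (fun=> c) i = c.
Proof.
elim: n i => [|n IHn] i //=; rewrite /avg (@rsum_ext b _ (fun=> c)) //.
by rewrite rsum_const; field; have := INRb_gt0; lra.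
Qed.

Lemma iter_avg_rsum n m (F : nat -> nat -> R) i :
  iter n (avg b) (fun s => rsum m (fun j => F j s)) i =
  rsum m (fun j => iter n (avg b) (F j) i).
Proof.
elim: m => [|m IHm] /=; first exact: iter_avg_const.
by rewrite iter_avgD IHm.
Qed.

(** * Moments of the digit sum and of the next carry *)

Lemma iter_avg_linear n c d i :
  iter n (avg b) (fun s => c * INR s + d) i =
  c * (INR i + INR n * (INR b - 1) / 2) + d.
Proof.
have b0 := INRb_gt0; elim: n i => [|n IHn] i; first by simpl; lra.
rewrite iterS S_INR /avg (rsum_ext _ _ (fun t => 
  c * (INR i + INR n * (INR b - 1) / 2 + INR t) + d)); last first.
  by move=> t _; rewrite IHn plus_INR; lra.
by rewrite rsumD rsumZ rsum_shift rsum_const; field; lra.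
Qed.

(** Squared bias plus variance, each of the [n] independent digits contributing $(b^2-1)/12$. *)
Lemma iter_avg_sqr n c i :
  iter n (avg b) (fun s => (INR s - c) ^ 2) i =
  (INR i + INR n * (INR b - 1) / 2 - c) ^ 2 + INR n * (INR b ^ 2 - 1) / 12.
Proof.
have b0 := INRb_gt0; elim: n i => [|n IHn] i; first by simpl; lra.
rewrite iterS S_INR /avg (rsum_ext _ _ (fun t => 
  (INR i + INR n * (INR b - 1) / 2 - c + INR t) ^ 2 +
  INR n * (INR b ^ 2 - 1) / 12)); last first.
  by move=> t _; rewrite IHn plus_INR; lra.
by rewrite rsumD rsum_sqr_shift rsum_const; field; lra.
Qed.

Lemma carry_ext n f g i : f =1 g -> carry b n f i = carry b n g i.
Proof. by move=> fg; apply: iter_avg_ext => s. Qed.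

Lemma carry_le n f g i :
  (forall s, f s <= g s) -> carry b n f i <= carry b n g i.
Proof. by move=> fg; apply: iter_avg_le => s. Qed.

Lemma carryD n f g i :
  carry b n (fun k => f k + g k) i = carry b n f i + carry b n g i.
Proof. exact: (iter_avgD n (fun s => f (s %/ b)%N) (fun s => g (s %/ b)%N)).
  Qed.

Lemma carryZ n c f i : carry b n (fun k => c * f k) i = c * carry b n f i.
Proof. exact: (iter_avgZ n c (fun s => f (s %/ b)%N)). Qed.

Lemma carry_const n c i : carry b n (fun=> c) i = c.
Proof. exact: iter_avg_const. Qed.

(** Among the [b] consecutive integers starting at [s], exactly [s %% b] have a quotient one larger
    than that of [s]. *)
Lemma rsum_divn (F : nat -> R) s :
  rsum b (fun t => F ((s + t) %/ b)%N) =
  (INR b - INR (s %% b)) * F (s %/ b)%N + INR (s %% b) * F (s %/ b).+1.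
Proof.
have rb : (s %% b < b)%N by rewrite ltn_mod.
have -> : INR b - INR (s %% b) = INR (b - s %% b).
  by rewrite minus_INR //; apply/leP; apply: ltnW.
rewrite -{1}(subnK (ltnW rb)) rsum_split -!rsum_const.
have E t : ((s + t) %/ b = s %/ b + (s %% b + t) %/ b)%N.
  by rewrite {1}(divn_eq s b) -addnA divnMDl.
congr (_ + _); apply: rsum_ext => t tr; rewrite E; congr F.
  by rewrite [((_ + _) %/ b)%N]divn_small ?addn0 // -ltn_subRL.
rewrite [(s %% b + _)%N]addnA (subnKC (ltnW rb)) divnDl ?dvdnn // divnn b_gt0.
by rewrite [(t %/ b)%N]divn_small ?addn0 ?addn1 // (ltn_trans tr rb).
Qed.

Lemma INR_divn s : INR s = INR (s %/ b) * INR b + INR (s %% b).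
Proof. by rewrite {1}(divn_eq s b) plus_INR mult_INR. Qed.

(* Hermite's identity: [\sum_(t < b) (s + t) %/ b = s]. *)
Lemma avg_divn d s :
  avg b (fun s => INR (s %/ b) - d) s = / INR b * INR s + - d.
Proof.
have b0 := INRb_gt0.
rewrite /avg (rsum_divn (fun q => INR q - d)) [INR s]INR_divn S_INR.
by field; lra.
Qed.

(* A two-valued variable with values in {q, q+1} has variance at most 1/4. *)
Lemma avg_divn_sqr d s :
  avg b (fun s => (INR (s %/ b) - d) ^ 2) s <=
  / INR b ^ 2 * (INR s - INR b * d) ^ 2 + / 4.
Proof.
have b0 := INRb_gt0.
rewrite /avg (rsum_divn (fun q => (INR q - d) ^ 2)) [INR s]INR_divn S_INR.
set q := INR (s %/ b); set r := INR (s %% b).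
apply: Rminus_le.
have -> : / INR b * ((INR b - r) * (q - d) ^ 2 + r * (q + 1 - d) ^ 2) -
  (/ INR b ^ 2 * (q * INR b + r - INR b * d) ^ 2 + / 4) =
  - (r / INR b - / 2) ^ 2 by field; lra.
by have := pow2_ge_0 (r / INR b - / 2); lra.
Qed.

(** Averaging the floor over one digit makes it exactly linear, so the other [n - 1] digits
    contribute only their means. *)
Lemma carry_centered n i : (0 < n)%N ->
  carry b n (fun k => INR k - (INR n - 1) / 2) i =
  (INR i - (INR n - 1) / 2) / INR b.
Proof.
have b0 := INRb_gt0; case: n => // n _.
rewrite /carry iterSr (iter_avg_ext _ _ _ _ (avg_divn _)) iter_avg_linear S_INR.
by field; lra.
Qed.

(** One digit absorbs the floor at a cost of $1/4$; the others add variance $(n-1)(b^2-1)/12$ before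
    division by $b^2$. The constant is $(n+3)/12=(n-1)/12+1/3$ because $1/4\le(1-b^{-2})/3$ for
    $b\ge2$. *)
Lemma carry_centered_sqr n i : (0 < n)%N -> (1 < b)%N ->
  carry b n (fun k => (INR k - (INR n - 1) / 2) ^ 2) i <=
  (INR i - (INR n - 1) / 2) ^ 2 * / INR b ^ 2 +
  (INR n + 3) / 12 * (1 - / INR b ^ 2).
Proof.
have b0 := INRb_gt0; case: n => // n _ b1.
have b2 : 2 <= INR b by rewrite -[2]/(INR 2); apply: le_INR; apply/leP.
rewrite /carry iterSr; apply: Rle_trans.
  by apply: iter_avg_le => s; apply: avg_divn_sqr.
rewrite iter_avgD iter_avgZ iter_avg_const iter_avg_sqr S_INR.
set N := INR n; apply: Rminus_le.
set L := (X in X <= 0).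
have -> : L = / INR b ^ 2 / 3 - / 12 by rewrite /L; field; lra.
have : / INR b ^ 2 <= / 4; last lra.
by apply: Rinv_le_contravar; nra.
Qed.

(** * Contraction of Lipschitz constants *)

Lemma avg_succ g s : avg b (fun s => g s.+1) s = avg b g s.+1.
Proof. by rewrite /avg; congr (_ * _); apply: rsum_ext => t _; rewrite addSn.
  Qed.

Lemma iter_avg_succ n g i :
  iter n (avg b) g i.+1 = iter n (avg b) (fun s => g s.+1) i.
Proof.
elim: n i => [|n IHn] i //=; rewrite -avg_succ /avg.
by congr (_ * _); apply: rsum_ext => t _.
Qed.

(* Moving the state from [i] to [i.+1] changes the next carry for exactly one
   residue modulo [b] of the digit sum, and then only by one. *)
Lemma carry_lipschitz n f L : (0 < n)%N ->
  (forall k, Rabs (f k.+1 - f k) <= L) ->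
  forall k, Rabs (carry b n f k.+1 - carry b n f k) <= L / INR b.
Proof.
have b0 := INRb_gt0; case: n => // n _ fL k; rewrite /carry iter_avg_succ.
set g := fun s => f (s %/ b)%N.
have E : iter n.+1 (avg b) (fun s => g s.+1) k - iter n.+1 (avg b) g k =
    iter n (avg b) (fun s => / INR b * (f (s %/ b).+1 - f (s %/ b)%N)) k.
  rewrite !iterSr /Rminus -[- _]Rmult_1_l -Ropp_mult_distr_r Ropp_mult_distr_l.
  rewrite -iter_avgZ -iter_avgD; apply: iter_avg_ext => s.
  (* Two windows of [b] consecutive terms, shifted by one, differ only in their end terms. *)
  have -> : avg b (fun s => g s.+1) s =
      / INR b * (rsum b (fun t => g (s + t)%N) + g (s + b)%N - g s).
    rewrite /avg; congr (_ * _).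
    have := rsum_recl b (fun t => g (s + t)%N); rewrite /= addn0.
    rewrite (rsum_ext _ (fun t => g (s + t.+1)%N) (fun t => g (s + t).+1));
      first lra.
    by move=> t _; rewrite addnS.
  by rewrite /avg /g (divnDr s (dvdnn b)) divnn b_gt0 addn1; lra.
rewrite -/g E; apply: Rabs_le.
have H s : - (L / INR b) <= / INR b * (f (s %/ b).+1 - f (s %/ b)%N) <= L / INR
  b.
  have := fL (s %/ b)%N; set x := _ - _ => xL.
  have ib := Rinv_0_lt_compat _ b0.
  have := Rle_abs x; have := Rle_abs (- x); rewrite Rabs_Ropp /Rdiv; nra.
split.
  rewrite -(iter_avg_const n (- (L / INR b)) k).
  by apply: iter_avg_le => s; case: (H s).
rewrite -(iter_avg_const n (L / INR b) k).
by apply: iter_avg_le => s; case: (H s).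
Qed.

(** * The transition matrix as a finite difference *)

(** This is $(1-E)^m h$ at 0, where $E$ is the unit shift. *)
Definition altsum (m : nat) (h : nat -> R) : R :=
  rsum m.+1 (fun l => (-1) ^ l * INR 'C(m, l) * h l).

Lemma altsumS m h :
  altsum m.+1 h = altsum m h - altsum m (fun l => h l.+1).
Proof.
rewrite /altsum rsum_recl [rsum m.+1 (fun l => _ * h l)]rsum_recl !bin0.
rewrite (rsum_ext _ _ (fun l => (-1) ^ l.+1 * INR 'C(m, l.+1) * h l.+1 + (-1) *
  ((-1) ^ l * INR 'C(m, l) * h l.+1))); last first.
  by move=> l _; rewrite binS plus_INR /=; lra.
rewrite rsumD rsumZ (@rsum_trunc m m.+1) //; first lra.
by move=> k km; rewrite bin_small ?INR_0 /=; [lra | lia].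
Qed.

Lemma altsum1 h : altsum 1 h = h 0%N - h 1%N.
Proof. by rewrite /altsum; simpl; lra. Qed.

Lemma altsum_ext m h h' :
  (forall l, h l = h' l) -> altsum m h = altsum m h'.
Proof. by move=> hh; apply: rsum_ext => l _; rewrite hh. Qed.

Lemma altsumB m h h' :
  altsum m (fun l => h l - h' l) = altsum m h - altsum m h'.
Proof.
rewrite /altsum (rsum_ext _ _ (fun l => (-1) ^ l * INR 'C(m, l) * h l + (-1) *
  ((-1) ^ l * INR 'C(m, l) * h' l))).
  by rewrite rsumD rsumZ; lra.
by move=> l _; lra.
Qed.

(* [psi n z] counts the n-tuples of naturals with sum < z. *)
Definition psi (n z : nat) : R := if z is y.+1 then INR 'C(y + n, n) else 0.

(** Group the tuples of length [n.+1] by their first coordinate [t]: those with [t >= m] number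
    [psi n.+1 (z - m)]. Truncated subtraction is harmless because [psi n 0 = 0]. *)
Lemma rsum_psi n z m :
  rsum m (fun t => psi n (z - t)) = psi n.+1 z - psi n.+1 (z - m).
Proof.
elim: m => [|m IHm] /=; first by rewrite subn0; lra.
rewrite IHm subnS; case: (z - m)%N => [|[|y]] /=; first lra.
  by rewrite !add0n !binn; simpl; lra.
by rewrite addSnnS -addSnnS addSn binS addSnnS plus_INR; lra.
Qed.

(** Start from $[\lfloor i/b\rfloor=j]=[i<(j+1)b]-[i<jb]$, a first difference of [psi 0]. Averaging
    over one more digit gives [psi n.+1] at two points [b] apart, which raises the order of the
    difference by one. *)
Lemma carry_delta n i j :
  carry b n (fun k => if k == j then 1 else 0) i =
  / INR b ^ n * altsum n.+1 (fun l => psi n (j.+1 * b - l * b - i)).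
Proof.
have b0 := INRb_gt0; rewrite /carry; elim: n i => [|n IHn] i.
  rewrite altsum1 !mul0n subn0 mul1n /psi pow_O Rinv_1 Rmult_1_l /=.
  have := divn_eq i b; have := ltn_pmod i b_gt0.
  case: eqP => [<-|ne] lt ei.
    case: ((i %/ b).+1 * b - i)%N (subn_gt0 i ((i %/ b).+1 * b)%N) => [|y] e.
      by exfalso; lia.
    rewrite (_ : _ - b - i = 0)%N; last by lia.
    by rewrite addn0 bin0 /=; lra.
  have [le|gt] := leqP (i %/ b).+1 j.
    have : (i < j * b)%N by nia.
    case e1 : (j.+1 * b - i)%N => [|y]; case e2 : (j.+1 * b - b - i)%N => [|z];
      try lia.
    by rewrite !addn0 !bin0 /=; lra.
  rewrite (_ : j.+1 * b - i = 0)%N; last by nia.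
  by rewrite (_ : _ - b - i = 0)%N; [simpl; lra | nia].
rewrite iterS /avg (rsum_ext _ _ (fun t => / INR b ^ n * altsum n.+1 (fun l =>
  psi n (j.+1 * b - l * b - i - t)))); last first.
  move=> t _; rewrite IHn; congr (_ * _).
  by apply: altsum_ext => l; rewrite subnDA.
rewrite rsumZ -Rmult_assoc -Rinv_mult -/(INR b ^ n.+1); congr (_ * _).
rewrite {1}/altsum rsum_exchange altsumS -altsumB; apply: rsum_ext => l _.
rewrite rsumZ rsum_psi; congr (_ * (_ - psi _ _)).
by rewrite mulSn; lia.
Qed.

Lemma psi_bin n i j l : (i < n)%N ->
  psi n (j.+1 * b - l * b - i) =
  INR 'C((n - 1 - i) + (j + 1 - l) * b, n).
Proof.
move=> ltin; rewrite -mulnBl addn1.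
case e : (_ - i)%N => [|y] /=.
  by rewrite bin_small //; lia.
by congr (INR 'C(_, _)); lia.
Qed.

(** Once [l] exceeds [j - i %/ b], one has $(j+1-l)b\le i$, so the upper index is below [n] and the
    binomial vanishes. The sum can thus run over the full range of a finite difference. *)
Lemma carriesP_altsum n i j : (i < n)%N -> (j < n)%N ->
  carriesP b n i j = / INR b ^ n *
  altsum n.+1 (fun l => INR 'C((n - 1 - i) + (j + 1 - l) * b, n)).
Proof.
move=> ltin ltjn; rewrite /carriesP; congr (_ * _).
have z l : (j < l + i %/ b)%N -> 'C(n - 1 - i + (j + 1 - l) * b, n) = 0%N.
  move=> lt; apply: bin_small; have := leq_trunc_div i b; nia.
case: leqP => [le|gt]; rewrite /altsum.
  rewrite [RHS](@rsum_trunc (j - i %/ b).+1) // => [|k kj].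
    by move: (i %/ b)%N => q; lia.
  by rewrite z; [simpl; lra | lia].
rewrite (rsum_ext _ _ (fun=> 0)) ?rsum_const; first lra.
by move=> k _; rewrite z; [simpl; lra | lia].
Qed.

Lemma carriesP_carry n i j : (i < n)%N -> (j < n)%N ->
  carriesP b n i j = carry b n (fun k => if k == j then 1 else 0) i.
Proof.
move=> ltin ltjn; rewrite carry_delta carriesP_altsum //; congr (_ * _).
by apply: altsum_ext => l; rewrite psi_bin.
Qed.

(** From [i < n] the total to be divided is at most $n-1+n(b-1)<nb$, so the next carry is again
    below [n] and the finite matrix loses no mass. *)
Lemma rsum_carriesP n f i : (i < n)%N ->
  rsum n (fun j => carriesP b n i j * f j) = carry b n f i.
Proof.
move=> ltin.
rewrite (rsum_ext _ _ (fun j => iter n (avg b) (fun s => (if j == (s %/ b)%N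
  then 1 else 0) * f j) i)); last first.
  move=> j ltjn; rewrite carriesP_carry // Rmult_comm /carry -iter_avgZ.
  by apply: iter_avg_ext => s; rewrite Rmult_comm eq_sym.
rewrite -iter_avg_rsum; apply: iter_avg_local => s les.
by rewrite rsum_delta // ltn_divLR //; nia.
Qed.

Lemma rsum_carriesPpow n r f i : (i < n)%N ->
  rsum n (fun j => carriesPpow b n r i j * f j) = iter r (carry b n) f i.
Proof.
move=> ltin; elim: r f => [|r IHr] f.
  rewrite -[RHS](rsum_delta n i f ltin) /=; apply: rsum_ext => k _.
  by case: (Nat.eqb_spec i k); case: eqP => // *; congruence.
rewrite iterSr -IHr /=.
rewrite (rsum_ext _ _ (fun j => rsum n (fun k => carriesPpow b n r i k *
  (carriesP b n k j * f j)))); last first.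
  by move=> j _; rewrite Rmult_comm -rsumZ; apply: rsum_ext => k _; lra.
rewrite rsum_exchange; apply: rsum_ext => k ltkn.
by rewrite rsumZ rsum_carriesP.
Qed.

End Carry.

(** * The unique permutation sorting an injective family *)

Section Sorting.

Variables (n : nat) (f : 'I_n -> nat).
Hypothesis f_inj : injective f.

Definition below (x : 'I_n) : nat := #|[pred y | f y < f x]%N|.

Lemma below_lt x : (below x < n)%N.
Proof.
rewrite -[X in (_ < X)%N]card_ord; apply: proper_card.
by apply/properP; split; [apply/subsetP | exists x; rewrite // inE ltnn].
Qed.

Definition rank (x : 'I_n) : 'I_n := Ordinal (below_lt x).

Lemma rank_mono x y : (f x < f y)%N -> (rank x < rank y)%N.
Proof.
move=> xy; apply: proper_card; apply/properP; split.
  by apply/subsetP => z; rewrite !inE => /ltn_trans; apply.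
by exists x; rewrite !inE // ltnn.
Qed.

Lemma rank_inj : injective rank.
Proof.
move=> x y /(congr1 val) /= e; apply: f_inj; apply/eqP.
by have := @rank_mono x y; have := @rank_mono y x; rewrite /=; lia.
Qed.

Definition sorts (s : 'S_n) : bool :=
  [forall k : 'I_n, forall k' : 'I_n, (k' == k.+1 :> nat) ==> (f (s k) < f (s
    k'))%N].

Lemma sorts_mono (s : 'S_n) : sorts s ->
  forall k k' : 'I_n, (f (s k) < f (s k'))%N = (k < k')%N.
Proof.
move=> /forallP H.
have inc (k k' : 'I_n) : (k < k')%N -> (f (s k) < f (s k'))%N.
  case: k' => p; elim: p k => [|p IHp] k lt // kp.
  have ltp : (p < n)%N by apply: ltnW.
  have step : (f (s (Ordinal ltp)) < f (s (Ordinal lt)))%N.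
    by have /forallP/(_ (Ordinal lt)) := H (Ordinal ltp); rewrite /= eqxx.
  have : (k <= p)%N by [].
  rewrite leq_eqVlt => /orP[/eqP e|kp'].
    by rewrite (_ : k = Ordinal ltp) //; apply: val_inj.
  by apply: ltn_trans step; apply: IHp.
move=> k k'; case: (ltngtP k k') => [/inc -> //|/inc|/val_inj ->].
  by move/ltnW; rewrite leqNgt => /negbTE.
by rewrite ltnn.
Qed.

(** If [s] sorts, exactly [k] values lie below the one at [s k], so [rank] inverts [s]. Conversely,
    [rank] is strictly monotone in [f]. *)
Lemma sorts_rank (s : 'S_n) : sorts s = (s == (perm rank_inj)^-1%g).
Proof.
apply/idP/eqP => [srt|->].
  have rs k : rank (s k) = k.
    apply: val_inj => /=; rewrite /below -sum1_card (reindex_inj (@perm_inj _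
      s)).
    rewrite (eq_bigl (fun k' : 'I_n => k' < k)%N) => [|k'].
      by rewrite -(big_ord_widen n (fun=> 1%N)) ?sum1_card ?card_ord // ltnW.
    by rewrite inE sorts_mono.
  by apply/permP => k; apply: (@perm_inj _ (perm rank_inj)); rewrite permKV
    permE rs.
apply/forallP => k; apply/forallP => k'; apply/implyP => /eqP kk'.
set x := _ k; set y := _ k'.
have ex : rank x = k by rewrite -(permE rank_inj) permKV.
have ey : rank y = k' by rewrite -(permE rank_inj) permKV.
have : (rank x < rank y)%N by rewrite ex ey kk'.
move=> lt; rewrite ltnNge leq_eqVlt; apply/norP; split.
  by apply/eqP => /f_inj e; rewrite e ltnn in lt.
by apply/negP => /rank_mono; rewrite ltnNge ltnW.
Qed.

End Sorting.

(** * Worpitzky's identity *)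

(* Adding to [a k] the number of indices [j < k] with [e j] makes the sequence
   strictly increasing. *)
Lemma card_weak_sequences (e : nat -> bool) n m :
  #|[set a : {ffun 'I_n.+1 -> 'I_m.+1} |
      [forall k : 'I_n.+1, forall k' : 'I_n.+1,
         (k' == k.+1 :> nat) ==> (a k < a k' + e k)%N]]| =
  'C(m.+1 + \sum_(k < n) e k, n.+1).
Proof.
pose E k := (\sum_(j < k) e j)%N.
have ES k : E k.+1 = (E k + e k)%N by rewrite /E big_ord_recr.
have Emon k d : (E k <= E (k + d) <= E k + d)%N.
  by elim: d => [|d IHd]; rewrite ?addn0 ?leqnn // addnS ES; case: (e _); lia.
have Ele k : (k <= n)%N -> (E k <= E n <= E k + (n - k))%N.
  by move=> kn; have := Emon k (n - k)%N; rewrite subnKC.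
pose M := (m + E n)%N.
rewrite -/(E n) -[(m.+1 + _)%N]/M.+1 -card_ltn_sorted_tuples.
(* The shifted values stay at most [m + E n], so [inord] never falls back to its default. *)
pose sh (a : {ffun 'I_n.+1 -> 'I_m.+1}) : n.+1.-tuple 'I_M.+1 :=
  [tuple inord (a k + E k) | k < n.+1].
have shE a (k : 'I_n.+1) : tnth (sh a) k = (a k + E k)%N :> nat.
  rewrite tnth_mktuple inordK // ltnS /M.
  have := ltn_ord (a k); have := ltn_ord k; move=> kn ak.
  by have := Ele k; lia.
have sh_inj : injective sh.
  move=> a a' eaa'; apply/ffunP => k; apply: val_inj => /=.
  by have := shE a k; have := shE a' k; rewrite eaa' => -> /eqP; rewrite
    eqn_add2r => /eqP.
rewrite -(card_imset _ sh_inj); apply: eq_card => t; rewrite inE.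
have nthE (k : 'I_n.+1) : nth 0%N (map val t) k = tnth t k.
  by rewrite (nth_map ord0) ?size_tuple // -tnth_nth.
have sortedE : reflect (forall k k' : 'I_n.+1, k' = k.+1 :> nat -> (tnth t k <
  tnth t k')%N) (sorted ltn (map val t)).
  apply: (iffP (sortedP 0%N)); rewrite size_map size_tuple => H.
    by move=> k k' kk'; rewrite -!nthE kk'; apply: H; rewrite -kk'.
  move=> i lt; have lt' := ltnW lt.
  by have := H (Ordinal lt') (Ordinal lt) erefl; rewrite -!nthE.
apply/imsetP/sortedE => [[a]|H].
  rewrite inE => /forallP H -> k k' kk'; rewrite !shE kk' ES.
  by have /forallP/(_ k')/implyP/(_ (introT eqP kk')) := H k; lia.
(* Surjectivity: a strictly increasing [t] lies above [E] by upward induction, and below [m + E] by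
   downward induction from its last entry, so [t - E] has values in ['I_m.+1]. *)
have lo p (lt : (p < n.+1)%N) : (E p <= tnth t (Ordinal lt))%N.
  elim: p lt => [|p IHp] lt; first by rewrite /E big_ord0.
  have := H (Ordinal (ltnW lt)) (Ordinal lt) erefl.
  by have := IHp (ltnW lt); rewrite ES; case: (e p); lia.
have hi d p (lt : (p < n.+1)%N) : (p + d = n)%N -> (tnth t (Ordinal lt) <= m +
  E p)%N.
  elim: d p lt => [|d IHd] p lt pd.
    by have := ltn_ord (tnth t (Ordinal lt)); rewrite ltnS /M; have -> : E p =
      E n by congr E; lia.
  have lt1 : (p.+1 < n.+1)%N by lia.
  have := H (Ordinal lt) (Ordinal lt1) erefl.
  have := IHd _ lt1; rewrite ES; case: (e p); lia.
have {}lo (k : 'I_n.+1) : (E k <= tnth t k)%N by case: k => p lt; apply: lo.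
have {}hi (k : 'I_n.+1) : (tnth t k <= m + E k)%N.
  by case: k => p lt; apply: (hi (n - p)%N); lia.
pose a := [ffun k : 'I_n.+1 => inord (tnth t k - E k) : 'I_m.+1].
have aE k : a k = (tnth t k - E k)%N :> nat.
  by rewrite ffunE inordK // ltnS leq_subLR addnC.
exists a.
  rewrite inE; apply/forallP => k; apply/forallP => k'; apply/implyP => /eqP
    kk'.
  have := H k k' kk'; rewrite !aE kk' ES.
  by have := lo k; have := lo k'; rewrite kk' ES; lia.
apply: eq_from_tnth => k; apply: val_inj; rewrite /= shE aE subnK //.
Qed.

Lemma descents_weak_steps n (s : 'S_n.+1) :
  (descents s + \sum_(k < n) (s (inord k) < s (inord k.+1)))%N = n.
Proof.
rewrite /descents -sum1_card big_mkcond big_ord_recr /=.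
(* The last position has no successor, hence is never a descent. *)
rewrite [X in (_ + X + _)%N](_ : _ = 0)%N; last first.
  rewrite inE; case: existsP => // -[k /andP[/eqP e _]].
  by have := ltn_ord k; rewrite e ltnn.
rewrite addn0 -big_split /= -[RHS]card_ord -sum1_card; apply: eq_bigr => k _.
have i1 : inord k = widen_ord (leqnSn n) k.
  by apply: val_inj; rewrite /= inordK // ltnW // ltnS.
have i2 : nat_of_ord (inord k.+1 : 'I_n.+1) = k.+1 by apply: inordK; rewrite
  ltnS.
rewrite i1 inE; case: existsP => [[k' /andP[/eqP e lt]]|H].
  have -> : inord k.+1 = k' by apply: val_inj; rewrite /= i2 e.
  by rewrite ltnNge ltnW.
rewrite ltn_neqAle leqNgt.
have -> /= : (s (widen_ord (leqnSn n) k) != s (inord k.+1) :> nat).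
  by apply/eqP => /val_inj/perm_inj/(congr1 (@nat_of_ord _)); rewrite i2 /=;
    lia.
by case: ltnP => // lt; case: H; exists (inord k.+1); rewrite i2 eqxx.
Qed.

Lemma descents_lt n (s : 'S_n.+1) : (descents s <= n)%N.
Proof. by rewrite -{2}(descents_weak_steps n s) leq_addr. Qed.

Lemma ltn_lex n u v p q : (p < n)%N -> (q < n)%N ->
  (u * n + p < v * n + q)%N = (u < v + (p < q))%N.
Proof. by move=> pn qn; case: (ltngtP u v) => [||->]; case: (ltnP p q); nia.
  Qed.

(* Worpitzky's identity: a word [w] is sorted stably by exactly one permutation,
   and the words sorted by [s] are those weakly increasing along [s], strictly
   at the descents of [s]. *)
Lemma worpitzky n m :
  (\sum_(s : 'S_n.+1) 'C(n - descents s + m.+1, n.+1) = m.+1 ^ n.+1)%N.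
Proof.
(* The key compares letters first and positions second, which encodes stable sorting. *)
pose key (w : {ffun 'I_n.+1 -> 'I_m.+1}) (x : 'I_n.+1) := (w x * n.+1 + x)%N.
have key_inj w : injective (key w).
  move=> x y /(congr1 (modn^~ n.+1)).
  by rewrite /key !modnMDl !modn_small // => /val_inj.
pose W s := [set w | sorts n.+1 (key w) s].
transitivity (\sum_(s : 'S_n.+1) #|W s|)%N.
  apply: eq_bigr => s _.
  pose e k := (s (inord k) < s (inord k.+1))%N.
  have -> : (n - descents s = \sum_(k < n) e k)%N.
    by rewrite -{1}(descents_weak_steps n s) addKn.
  rewrite addnC -card_weak_sequences.
  (* Reading [w] along [s] turns sortedness into the step condition of [card_weak_sequences]: ties
     are allowed exactly at ascents. *)
  pose h (w : {ffun 'I_n.+1 -> 'I_m.+1}) := [ffun k => w (s k)].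
  have h_bij : bijective h.
    exists (fun a : {ffun 'I_n.+1 -> 'I_m.+1} => [ffun x => a ((s^-1)%g x)]) =>
      w; apply/ffunP => x.
      by rewrite !ffunE permKV.
    by rewrite !ffunE permK.
  rewrite -[RHS](card_imset _ (bij_inj h_bij)).
  apply: eq_card => a; case: h_bij => g hK gK.
  rewrite -[a]gK; move: (g a) => w; rewrite (mem_imset _ _ (can_inj hK)) !inE.
  apply: eq_forallb => k; apply: eq_forallb => k'.
  case: eqP => //= kk'; rewrite /key !ffunE.
  have -> : e k = (s k < s k')%N by rewrite /e -kk' !inord_val.
  by rewrite ltn_lex.
transitivity #|{: {ffun 'I_n.+1 -> 'I_m.+1}}|; last by rewrite card_ffun
  !card_ord.
rewrite -[RHS]sum1_card (eq_bigr (fun s => \sum_w (w \in W s)))%N => [|s _];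
  last first.
  by rewrite -sum1_card big_mkcond.
rewrite exchange_big; apply: eq_bigr => w _ /=.
rewrite (bigD1 ((perm (rank_inj _ _ (key_inj w)))^-1)%g) //= inE sorts_rank
  eqxx.
by rewrite big1 // => s; rewrite inE sorts_rank => /negbTE ->.
Qed.

(** * Stationarity of the Eulerian weights *)

Lemma INR_sum n (F : nat -> nat) :
  INR (\sum_(k < n) F k) = rsum n (fun k => INR (F k)).
Proof.
elim: n => [|n IHn]; first by rewrite big_ord0.
by rewrite big_ord_recr plus_INR IHn.
Qed.

Lemma INR_expn m n : INR (m ^ n)%N = INR m ^ n.
Proof. by elim: n => //= n IHn; rewrite expnS mult_INR IHn. Qed.

Lemma sum_eulerian n (F : nat -> nat) :
  (\sum_(k < n.+1) eulerian n.+1 k * F k = \sum_(s : 'S_n.+1) F (descents s))%N.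
Proof.
rewrite (partition_big (fun s : 'S_n.+1 => inord (descents s) : 'I_n.+1) predT)
  //=.
apply: eq_bigr => k _.
have E (s : 'S_n.+1) : (inord (descents s) == k) = (descents s == k).
  by rewrite -val_eqE /= inordK // ltnS descents_lt.
rewrite (eq_bigl _ _ E) (eq_bigr (fun=> F k)) => [|s /eqP -> //].
by rewrite sum_nat_const /eulerian cardsE.
Qed.

Lemma worpitzky_eulerian n m : (0 < n)%N ->
  rsum n (fun k => INR (eulerian n k) * INR 'C(n - 1 - k + m, n)) = INR m ^ n.
Proof.
case: n => // n _.
rewrite (rsum_ext _ _ (fun k => INR (eulerian n.+1 k * 'C(n - k + m, n.+1))));
  last first.
  by move=> k _; rewrite mult_INR subn1.
rewrite -(INR_sum _ (fun k => eulerian n.+1 k * 'C(n - k + m, n.+1))%N)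
  (sum_eulerian n (fun k => 'C(n - k + m, n.+1))).
(* For [m = 0] both sides vanish: each binomial has too small an upper index, and the exponent is
   positive. *)
rewrite -INR_expn; congr INR; case: m => [|m]; last by rewrite worpitzky.
rewrite big1 => [|s _]; first by rewrite exp0n.
by rewrite bin_small // addn0 ltnS leq_subr.
Qed.

(** Worpitzky's identity turns the binomials into $((j+1-l)b)^n$, and $b^n$ cancels against the
    normalisation. *)
Lemma eulerian_altsum b n j : (0 < b)%N -> (0 < n)%N -> (j < n)%N ->
  rsum n (fun i => INR (eulerian n i) * carriesP b n i j) =
  altsum n.+1 (fun l => INR (j + 1 - l) ^ n).
Proof.
move=> b0 n0 jn; have b0' := INRb_gt0 _ b0.
rewrite (rsum_ext _ _ (fun i => / INR b ^ n * (rsum n.+2 (fun l => (-1) ^ l *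
  INR 'C(n.+1, l) *
   (INR (eulerian n i) * INR 'C((n - 1 - i) + (j + 1 - l) * b, n)))))); last
     first.
  move=> i ltin; rewrite carriesP_altsum // /altsum.
  rewrite -Rmult_assoc (Rmult_comm (INR _)) Rmult_assoc -rsumZ.
  by congr (_ * _); apply: rsum_ext => l _; lra.
rewrite rsumZ rsum_exchange -rsumZ; apply: rsum_ext => l _.
rewrite rsumZ worpitzky_eulerian // mult_INR Rpow_mult_distr.
by field; apply: pow_nonzero; lra.
Qed.

Lemma eulerian_stationary b n j : (0 < b)%N -> (0 < n)%N -> (j < n)%N ->
  rsum n (fun i => INR (eulerian n i) * carriesP b n i j) = INR (eulerian n j).
Proof.
move=> b0 n0 jn.
(* Base 1 may replace [b]; there every digit is 0 and the chain stays put. *)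
rewrite eulerian_altsum // -(eulerian_altsum 1) //.
rewrite -(rsum_delta n j (fun k => INR (eulerian n k)) jn).
apply: rsum_ext => i ltin; rewrite carriesP_carry // Rmult_comm; congr (_ * _).
rewrite /carry -[i in RHS]divn1.
elim: n i {n0 jn ltin} => // n IHn i.
by rewrite iterS /avg /= addn0 IHn Rinv_1; lra.
Qed.

Lemma carriesPi_ge0 n k : 0 <= carriesPi n k.
Proof.
apply: Rle_mult_inv_pos; first exact: pos_INR.
by apply: lt_0_INR; apply/ltP; apply: fact_gt0.
Qed.

Lemma rsum_carriesPi n : (0 < n)%N -> rsum n (carriesPi n) = 1.
Proof.
move=> n_gt0.
have f0 : INR n`! <> 0 by apply: not_0_INR; have := fact_gt0 n; lia.
rewrite (rsum_ext _ _ (fun k => / INR n`! * INR (eulerian n k * 1))) => [|k _].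
  rewrite rsumZ -(INR_sum _ (fun k => eulerian n k * 1)%N).
  case: n n_gt0 f0 => // m _ f0; rewrite (sum_eulerian m (fun=> 1%N)) sum1_card.
  by rewrite card_Sn; field.
by rewrite muln1 /carriesPi Rmult_comm.
Qed.

(** * Moments of the stationary distribution *)

Section Stationary.

Variables b n : nat.
Hypotheses (b_gt1 : (1 < b)%N) (n_gt0 : (0 < n)%N).

Let b_gt0 : (0 < b)%N := ltnW b_gt1.
Let mu := (INR n - 1) / 2.

Lemma INRb_ge2 : 2 <= INR b.
Proof. by rewrite -[2]/(INR 2); apply: le_INR; apply/leP. Qed.

Lemma carriesPi_carry f :
  rsum n (fun k => carriesPi n k * carry b n f k) =
  rsum n (fun k => carriesPi n k * f k).
Proof.
rewrite (rsum_ext _ _ (fun k => rsum n (fun j => / INR n`! * f j * (INR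
  (eulerian n k) * carriesP b n k j)))); last first.
  move=> k kn; rewrite -(rsum_carriesP b b_gt0 n f k kn) -rsumZ.
  by apply: rsum_ext => j _; rewrite /carriesPi /Rdiv; lra.
rewrite rsum_exchange; apply: rsum_ext => j jn.
by rewrite rsumZ eulerian_stationary // /carriesPi /Rdiv; lra.
Qed.

Lemma carriesPi_iter_carry r f :
  rsum n (fun k => carriesPi n k * iter r (carry b n) f k) =
  rsum n (fun k => carriesPi n k * f k).
Proof. by elim: r => //= r <-; rewrite carriesPi_carry. Qed.

(** Stationarity gives $m=m/b$ for the centered mean $m$. *)
Lemma carriesPi_centered :
  rsum n (fun k => carriesPi n k * (INR k - mu)) = 0.
Proof.
have b2 := INRb_ge2; set m := rsum _ _.
have : m = / INR b * m.
  rewrite {1}/m -carriesPi_carry -rsumZ; apply: rsum_ext => k _.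
  by rewrite carry_centered // -/mu /Rdiv; lra.
have : / INR b <= / 2 by apply: Rinv_le_contravar; lra.
nra.
Qed.

Lemma carriesPi_mean : rsum n (fun k => carriesPi n k * INR k) = mu.
Proof.
have := carriesPi_centered.
rewrite (rsum_ext _ _ (fun k => carriesPi n k * INR k + - mu * carriesPi n k)).
  by rewrite rsumD rsumZ rsum_carriesPi //; lra.
by move=> k _; lra.
Qed.

Lemma Rinv_sqr_base : 0 < / INR b ^ 2 <= / 4.
Proof.
have b2 := INRb_ge2; split; first by apply: Rinv_0_lt_compat; nra.
by apply: Rinv_le_contravar; nra.
Qed.

(** Averaging the one-step bound over the stationary law gives $v\le
    b^{-2}v+\frac{n+3}{12}(1-b^{-2})$. *)
Lemma carriesPi_variance :
  rsum n (fun k => carriesPi n k * (INR k - mu) ^ 2) <= (INR n + 3) / 12.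
Proof.
have b2 := Rinv_sqr_base; set v := rsum _ _.
suff : v <= / INR b ^ 2 * v + (INR n + 3) / 12 * (1 - / INR b ^ 2) by nra.
rewrite -[X in _ <= _ + X]Rmult_1_r -{2}(rsum_carriesPi n n_gt0).
rewrite {1}/v -carriesPi_carry -!rsumZ -rsumD; apply: rsum_le => k _.
have := Rmult_le_compat_l _ _ _ (carriesPi_ge0 n k) (carry_centered_sqr b b_gt0
  n k n_gt0 b_gt1).
by rewrite -/mu; lra.
Qed.

(** * The upper bound *)

(** Passing through state 0 gives $i+k$ in place of $|i-k|$; its stationary mean over $k$ is
    $i+(n-1)/2$, as the upper bound requires. *)
Lemma iter_carry_lipschitz r f L :
  (forall k, Rabs (f k.+1 - f k) <= L) ->
  forall i k, Rabs (iter r (carry b n) f i - iter r (carry b n) f k) <=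
  L / INR b ^ r * (INR i + INR k).
Proof.
have b2 := INRb_ge2; move=> fL.
have step k : Rabs (iter r (carry b n) f k.+1 - iter r (carry b n) f k) <= L /
  INR b ^ r.
  elim: r k => [|r IHr] k; first by rewrite /= /Rdiv Rinv_1 Rmult_1_r.
  have := carry_lipschitz b b_gt0 n _ _ n_gt0 IHr k.
  rewrite /= /Rdiv Rinv_mult; lra.
move: (iter r (carry b n) f) step => h step.
have L0 : 0 <= L / INR b ^ r by apply: Rle_trans (Rabs_pos _) (step 0%N).
have from0 k : Rabs (h k - h 0%N) <= L / INR b ^ r * INR k.
  elim: k => [|k IHk]; first by rewrite Rminus_diag Rabs_R0 /=; lra.
  have := Rabs_triang (h k.+1 - h k) (h k - h 0%N); have := step k.
  have -> : h k.+1 - h k + (h k - h 0%N) = h k.+1 - h 0%N by lra.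
  by rewrite S_INR; lra.
move=> i k; have := Rabs_triang (h i - h 0%N) (- (h k - h 0%N)).
have -> : h i - h 0%N + - (h k - h 0%N) = h i - h k by lra.
rewrite Rabs_Ropp.
by have := from0 i; have := from0 k; lra.
Qed.

Lemma tv_upper i r : (i < n)%N ->
  tv n (carriesPpow b n r i) (carriesPi n) <=
  ((INR n - 1) / 2 + INR i) / INR b ^ r.
Proof.
move=> ltin; rewrite /tv -/mu.
(* The sign of the difference turns absolute values into a difference of expectations; its Lipschitz
   constant 2 cancels the factor $1/2$ in [tv]. *)
pose f x := if Rle_dec 0 (carriesPpow b n r i x - carriesPi n x) then 1 else -1.
have fL k : Rabs (f k.+1 - f k) <= 2.
  by rewrite /f; do 2 destruct Rle_dec; apply: Rabs_le; rewrite /=; lra.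
set h := iter r (carry b n) f.
have -> : rsum n (fun x => Rabs (carriesPpow b n r i x - carriesPi n x)) =
    rsum n (fun k => carriesPi n k * (h i - h k)).
  rewrite (rsum_ext _ _ (fun x => carriesPpow b n r i x * f x + -1 * (carriesPi
    n x * f x))).
    rewrite rsumD rsumZ rsum_carriesPpow // -(carriesPi_iter_carry r) -/h.
    have {1}-> : h i = rsum n (fun k => h i * carriesPi n k).
      by rewrite rsumZ rsum_carriesPi //; lra.
    rewrite -rsumZ -rsumD.
    by apply: rsum_ext => k _; lra.
  move=> x _; rewrite /f; destruct Rle_dec; rewrite /=; first by rewrite
    Rabs_right; lra.
  by rewrite Rabs_left; lra.
apply: (Rle_trans _ (/ 2 * rsum n (fun k => 2 / INR b ^ r * (INR i * carriesPi
  n k + carriesPi n k * INR k)))).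
  apply: Rmult_le_compat_l; first lra.
  apply: rsum_le => k _.
  have := iter_carry_lipschitz r f 2 fL i k; rewrite -/h => H.
  have := Rle_trans _ _ _ (Rle_abs _) H; have := carriesPi_ge0 n k; nra.
by rewrite rsumZ rsumD rsumZ rsum_carriesPi // carriesPi_mean /Rdiv; lra.
Qed.

(** * The lower bound *)

Lemma iter_carry_const r c i : iter r (carry b n) (fun=> c) i = c.
Proof.
elim: r i => //= r IHr i; rewrite -[RHS](carry_const b b_gt0 n c i).
by apply: carry_ext.
Qed.

(** The alternating formula hides positivity; it follows from monotonicity of the operator applied
    to the indicator of [j]. *)
Lemma carriesPpow_ge0 r i j : (i < n)%N -> (j < n)%N ->
  0 <= carriesPpow b n r i j.
Proof.
move=> ltin ltjn; rewrite -(rsum_delta n j (carriesPpow b n r i) ltjn).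
rewrite (rsum_ext _ _ (fun k => carriesPpow b n r i k * if k == j then 1 else
  0)); last first.
  by move=> k _; rewrite Rmult_comm.
rewrite rsum_carriesPpow // -{1}(iter_carry_const r 0 i).
elim: r i {ltin} => [|r IHr] i /=; first by case: ifP => _; lra.
by apply: (carry_le b b_gt0 n _ _ i) => s; apply: IHr.
Qed.

Lemma rsum_carriesPpow1 r i : (i < n)%N -> rsum n (carriesPpow b n r i) = 1.
Proof.
move=> ltin; rewrite -[RHS](iter_carry_const r 1 i) -rsum_carriesPpow //.
by apply: rsum_ext => k _; lra.
Qed.

Lemma iter_carry_centered r i :
  iter r (carry b n) (fun k => INR k - mu) i = (INR i - mu) / INR b ^ r.
Proof.
have b2 := INRb_ge2.
elim: r i => [|r IHr] i /=; first by rewrite /Rdiv Rinv_1 Rmult_1_r.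
rewrite (carry_ext _ b_gt0 _ _ (fun k => / INR b ^ r * (INR k - mu))); last
  first.
  by move=> k; rewrite IHr Rmult_comm.
rewrite carryZ // carry_centered // -/mu /Rdiv.
by rewrite Rinv_mult; lra.
Qed.

(** This iterates the affine recursion $x\mapsto b^{-2}x+V(1-b^{-2})$, whose fixed point is
    $V=(n+3)/12$. *)
Lemma iter_carry_centered_sqr r i :
  iter r (carry b n) (fun k => (INR k - mu) ^ 2) i <=
  (INR i - mu) ^ 2 * (/ INR b ^ r) ^ 2 + (INR n + 3) / 12 * (1 - (/ INR b ^ r)
    ^ 2).
Proof.
have b2 := INRb_ge2.
elim: r i => [|r IHr] i /=; first by rewrite Rinv_1; lra.
apply: Rle_trans; first by apply: carry_le => //; exact: IHr.
have := carry_centered_sqr b b_gt0 n i n_gt0 b_gt1; rewrite -/mu => H.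
rewrite (carry_ext _ b_gt0 _ _ (fun k => (/ INR b ^ r) ^ 2 * (INR k - mu) ^ 2 +
  (INR n + 3) / 12 * (1 - (/ INR b ^ r) ^ 2))); last by move=> k; lra.
rewrite carryD // carryZ // carry_const // Rinv_mult.
rewrite -(pow_inv _ 2) in H.
by have := Rmult_le_compat_l _ _ _ (pow2_ge_0 (/ INR b ^ r)) H; lra.
Qed.

(** Recentering at the true mean subtracts $d^2$, which cancels the squared bias and leaves at most
    $\frac{n+3}{12}(1-b^{-2r})$. *)
Lemma carriesPpow_variance r i : (i < n)%N ->
  rsum n (fun k => carriesPpow b n r i k *
    (INR k - (mu + (INR i - mu) / INR b ^ r)) ^ 2) <= (INR n + 3) / 12.
Proof.
move=> ltin; set d := (_ - _) / _.
rewrite (rsum_ext _ _ (fun k => carriesPpow b n r i k * (INR k - mu) ^ 2 +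
  (- 2 * d * (carriesPpow b n r i k * (INR k - mu)) + d ^ 2 * carriesPpow b n r
    i k))); last first.
  by move=> k _; lra.
rewrite !rsumD !rsumZ rsum_carriesPpow1 //.
rewrite (rsum_carriesPpow b b_gt0 n r (fun k => INR k - mu)) //
  iter_carry_centered -/d.
rewrite (rsum_carriesPpow b b_gt0 n r (fun k => (INR k - mu) ^ 2)) //.
have := iter_carry_centered_sqr r i.
have -> : (INR i - mu) ^ 2 * (/ INR b ^ r) ^ 2 = d ^ 2 by rewrite /d /Rdiv
  Rpow_mult_distr.
have := pow2_ge_0 (/ INR b ^ r); have := pos_INR n; nra.
Qed.

End Stationary.

(* Two distributions with common mass have means close relative to their
   standard deviations: compare [(a - c)^2 <= 2 (x - a)^2 + 2 (x - c)^2]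
   against the overlap [min (p x) (q x)], whose total mass is [1 - tv]. *)
Lemma tv_lower n (p q : nat -> R) a c v w :
  (forall k, (k < n)%N -> 0 <= p k) -> (forall k, (k < n)%N -> 0 <= q k) ->
  rsum n p = 1 -> rsum n q = 1 ->
  rsum n (fun k => p k * (INR k - a) ^ 2) <= v ->
  rsum n (fun k => q k * (INR k - c) ^ 2) <= w ->
  (1 - tv n p q) * (a - c) ^ 2 <= 2 * (v + w).
Proof.
move=> p0 q0 p1 q1 pv qw.
have -> : 1 - tv n p q = rsum n (fun k => Rmin (p k) (q k)).
  have : rsum n (fun k => Rabs (p k - q k)) = rsum n (fun k => p k + q k + -2 *
    Rmin (p k) (q k)).
    apply: rsum_ext => k _; rewrite /Rmin; case: Rle_dec => pq.
      by rewrite Rabs_left1; lra.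
    by rewrite Rabs_right; lra.
  by rewrite /tv !rsumD rsumZ p1 q1 => ->; lra.
apply: Rle_trans (_ : 2 * (rsum n (fun k => p k * (INR k - a) ^ 2) + rsum n
  (fun k => q k * (INR k - c) ^ 2)) <= _); last lra.
rewrite Rmult_comm -rsumZ -rsumD -rsumZ; apply: rsum_le => k kn.
have m0 : 0 <= Rmin (p k) (q k) by apply: Rmin_glb; [apply: p0 | apply: q0].
have mp := Rmin_l (p k) (q k); have mq := Rmin_r (p k) (q k).
have A := Rmult_le_compat_r _ _ _ (pow2_ge_0 (INR k - a)) mp.
have B := Rmult_le_compat_r _ _ _ (pow2_ge_0 (INR k - c)) mq.
(* Here $2u^2+2v^2-(u-v)^2=(u+v)^2$ with $u=k-a$ and $v=k-c$. *)
have := Rmult_le_pos _ _ m0 (pow2_ge_0 ((INR k - a) + (INR k - c))).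
by nra.
Qed.

Theorem theorem3p3 (n b : nat) (hn : (3 <= n)%N) (hb : (2 <= b)%N) :
  (forall (i r : nat), (i < n)%N ->
     tv n (carriesPpow b n r i) (carriesPi n)
       <= ((INR n - 1) / 2 + INR i) / (INR b ^ r))
  /\
  (forall (eps : R), 0 < eps < 1 -> forall (i r : nat), (i < n)%N ->
     (1 <= r)%N ->
     INR r <= logb (INR b) (eps * Rabs (INR i - (INR n - 1) / 2) / sqrt (INR n)) ->
     tv n (carriesPpow b n r i) (carriesPi n) >= 1 - eps).
Proof.
have n0 : (0 < n)%N by apply: ltn_trans hn.
split=> [i r ltin | eps eps01 i r ltin r1]; first exact: tv_upper.
set mu := (INR n - 1) / 2; rewrite /logb; set x := _ / sqrt _ => hr.
have b2 := INRb_ge2 b hb.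
have n3 : 3 <= INR n.
  by rewrite (_ : 3 = INR 3); [apply: le_INR; apply/leP | simpl; lra].
have s0 : 0 < sqrt (INR n) by apply: sqrt_lt_R0; lra.
have sn : sqrt (INR n) ^ 2 = INR n by rewrite pow2_sqrt; lra.
have lnb : 0 < ln (INR b) by rewrite -ln_1; apply: ln_increasing; lra.
have B0 : 0 < INR b ^ r by apply: pow_lt; lra.
have hlt : INR r * ln (INR b) <= ln x.
  have := Rmult_le_compat_r _ _ _ (Rlt_le _ _ lnb) hr.
  by rewrite /Rdiv Rmult_assoc Rinv_l; lra.
have rpos : 1 <= INR r by rewrite -[1]/(INR 1); apply: le_INR; apply/leP.
(* By convention [ln] is 0 at nonpositive arguments, which contradicts [hlt] since [r >= 1]. *)
have x0 : 0 < x.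
  case: (Rlt_dec 0 x) => // nx; move: hlt.
  have -> : ln x = 0 by rewrite /ln; case: Rlt_dec.
  nra.
have Bx : INR b ^ r <= x.
  case: (Rle_lt_dec (INR b ^ r) x) => // lt.
  have := ln_increasing _ _ x0 lt; rewrite ln_pow; last by lra.
  by lra.
set D := (INR i - mu) / INR b ^ r.
have hD : INR n <= (eps * D) ^ 2.
  have h1 : sqrt (INR n) <= eps * Rabs (INR i - mu) / INR b ^ r.
    apply: (Rmult_le_reg_r (INR b ^ r)) => //.
    have -> : eps * Rabs (INR i - mu) / INR b ^ r * INR b ^ r = x * sqrt (INR
      n).
      by rewrite /x -/mu; field; lra.
    by nra.
  have -> : (eps * D) ^ 2 = (eps * Rabs (INR i - mu) / INR b ^ r) ^ 2.
    by rewrite /D /Rdiv !Rpow_mult_distr pow2_abs; lra.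
  rewrite -sn; apply: pow_incr; lra.
(* The means differ by [D] and both variances are at most $(n+3)/12$, so the overlap $t$ satisfies
   $tD^2\le(n+3)/3$. *)
have := tv_lower n _ _ _ _ _ _ (fun k kn => carriesPpow_ge0 b n hb r i k ltin
  kn)
  (fun k _ => carriesPi_ge0 n k) (rsum_carriesPpow1 b n hb r i ltin)
  (rsum_carriesPi n n0) (carriesPpow_variance b n hb n0 r i ltin)
  (carriesPi_variance b n hb n0).
rewrite -/mu -/D (_ : mu + D - mu = D); last by lra.
set t := 1 - tv _ _ _ => ht.
suff : t <= eps by rewrite /t; lra.
case: (Rle_lt_dec t 0) => [|t0]; first by lra.
have h1 := Rmult_le_compat_l _ _ _ (Rlt_le _ _ t0) hD.
have h2 := Rmult_le_compat_l _ _ _ (pow2_ge_0 eps) ht.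
(* Uses $(n+3)/3\le n$, which follows from $n\ge3$. *)
have h3 : t * INR n <= eps ^ 2 * INR n by have := pow2_ge_0 eps; nra.
have h4 : t <= eps ^ 2 by apply: (Rmult_le_reg_r (INR n)); lra.
nra.
Qed.
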